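(* Let $y\in\mathbb{R}^p$ and $\lambda_1,\lambda_2>0$. In the orthogonal design (denoising) case, the solution $\hat\beta^{\lambda_1,\lambda_2}$ of the Bregman Lasso refitting step is $$\hat\beta^{\lambda_1,\lambda_2}=\mathrm{FT}\Big(y,\lambda_H,1+\frac{\lambda_1}{\lambda_2}\Big),\qquad \lambda_H=\Big(\frac1{\lambda_1}+\frac1{\lambda_2}\Big)^{-1},$$ where the firm-thresholding operator $\mathrm{FT}$ is defined for $\mu>0$, $\gamma>1$ component-wise, for $j\in\{1,\dots,p\}$, by $$\mathrm{FT}(y,\mu,\gamma)_j=\begin{cases}\frac{\gamma}{\gamma-1}\mathrm{ST}(y_j,\mu), & |y_j|\le\mu\gamma,\\ y_j, & |y_j|>\mu\gamma.\end{cases}$$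
   Context: Orthogonal design (denoising) case: $n=p$, $X=I_p$, and the $1/n$ factor is dropped. The Lasso is $\hat\beta^{\lambda_1}=\arg\min_{\beta\in\mathbb{R}^p}\frac12\|y-\beta\|_2^2+\lambda_1\|\beta\|_1$; put $\hat\rho^{\lambda_1}=(y-\hat\beta^{\lambda_1})/\lambda_1$. The Bregman Lasso refitting is $\hat\beta^{\lambda_1,\lambda_2}=\arg\min_{\beta\in\mathbb{R}^p}\frac12\|y-\beta\|_2^2+\lambda_2(\|\beta\|_1-\langle\hat\rho^{\lambda_1},\beta\rangle)$. The soft-thresholding operator is $\mathrm{ST}(u,\mu)=\mathrm{sign}(u)(|u|-\mu)_+$ for $u\in\mathbb{R}$, with $(t)_+=\max(t,0)$ (so $\mathrm{ST}(0,\mu)=0$). *)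

(* Defs.v *)
From HB Require Import structures.
From mathcomp Require Import all_boot all_order all_algebra.
From mathcomp Require Import reals.

Set Implicit Arguments.
Unset Strict Implicit.
Unset Printing Implicit Defensive.

Import Order.TTheory GRing.Theory Num.Theory.
Local Open Scope ring_scope.

(* The norm `|v| that the library puts on matrices is the sup norm, so the
   l1 and l2 norms are defined here. *)
Definition norm1 (R : realType) (p : nat) (v : 'cV[R]_p) : R :=
  \sum_(j < p) `|v j 0|.

Definition norm2 (R : realType) (p : nat) (v : 'cV[R]_p) : R :=
  Num.sqrt (\sum_(j < p) v j 0 ^+ 2).

Definition dotp (R : realType) (p : nat) (u v : 'cV[R]_p) : R :=
  \sum_(j < p) u j 0 * v j 0.

Definition is_argmin (R : realType) (T : Type) (f : T -> R) (x : T) : Prop :=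
  forall z : T, f x <= f z.

(* Orthogonal design: X is the identity and there is no 1/n factor. *)
Definition lasso_obj (R : realType) (p : nat) (y : 'cV[R]_p) (l1 : R)
    (b : 'cV[R]_p) : R :=
  2^-1 * norm2 (y - b) ^+ 2 + l1 * norm1 b.

(* The subgradient of the l1 norm at b1 read off from the optimality condition
   of the Lasso, when b1 is its solution. *)
Definition lasso_rho (R : realType) (p : nat) (y : 'cV[R]_p) (l1 : R)
    (b1 : 'cV[R]_p) : 'cV[R]_p :=
  l1^-1 *: (y - b1).

Definition bregman_obj (R : realType) (p : nat) (y : 'cV[R]_p) (l2 : R)
    (rho b : 'cV[R]_p) : R :=
  2^-1 * norm2 (y - b) ^+ 2 + l2 * (norm1 b - dotp rho b).

Definition soft_threshold (R : realType) (u mu : R) : R :=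
  Num.sg u * Num.max (`|u| - mu) 0.

(* Total in mu and gamma, but only meaningful for 0 < mu and 1 < gamma. *)
Definition firm_threshold (R : realType) (p : nat) (y : 'cV[R]_p)
    (mu gamma : R) : 'cV[R]_p :=
  \col_(j < p)
    (if `|y j 0| <= mu * gamma
     then gamma / (gamma - 1) * soft_threshold (y j 0) mu
     else y j 0).

(* Main.v *)
Require Import Defs.
From mathcomp Require Import all_boot all_order all_algebra.
From mathcomp Require Import reals.
From mathcomp Require Import ring lra.
Import Order.TTheory GRing.Theory Num.Theory.
Local Open Scope ring_scope.

(** The objective with weight [l] and shift [rho] separates over coordinates,
    and completing the square turns it into a Lasso with data [y + l *: rho].
    Hence its unique minimiser is the soft thresholding of [y + l *: rho] at
    level [l], whatever [rho] is.  The Lasso itself is the case [rho = 0], and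
    the refitting step reduces to a one-dimensional identity between composed
    soft thresholdings and firm thresholding. *)

Lemma soft_threshold_small {R : realType} (u mu : R) :
  `|u| <= mu -> soft_threshold u mu = 0.
Proof.
by move=> h; rewrite /soft_threshold max_r ?mulr0 // subr_le0.
Qed.

Lemma soft_threshold_large {R : realType} (u mu : R) :
  mu <= `|u| -> soft_threshold u mu = u - Num.sg u * mu.
Proof.
move=> h; rewrite /soft_threshold max_l ?subr_ge0 //.
by rewrite mulrBr -numEsg.
Qed.

Lemma soft_thresholdZ {R : realType} (c u mu : R) : 0 < c ->
  soft_threshold (c * u) (c * mu) = c * soft_threshold u mu.
Proof.
move=> c_gt0; rewrite /soft_threshold sgrM gtr0_sg // mul1r normrM gtr0_norm //.
by rewrite -mulrBr -[X in Num.max _ X](mulr0 c) -maxr_pMr ?ltW // mulrCA.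
Qed.

(** The shift moves [u] away from zero by [mu], keeping its sign, and thresholding pulls it back; at
    [u = 0] there is no shift since [Num.sg 0 = 0]. *)
Lemma soft_threshold_shift {R : realType} (u mu : R) : 0 <= mu ->
  soft_threshold (u + Num.sg u * mu) mu = u.
Proof.
move=> mu_ge0; have [->|u_gt0|u_lt0] := sgrP u.
- by rewrite mul0r addr0 soft_threshold_small ?normr0.
- rewrite mul1r soft_threshold_large ?ger0_norm ?gtr0_sg; lra.
- rewrite soft_threshold_large ?ltr0_norm ?ltr0_sg; lra.
Qed.

(* For [0 < mu], [(u - soft_threshold u mu) / mu] is a subgradient of the
   absolute value at [soft_threshold u mu]. *)
Lemma soft_threshold_subgradient {R : realType} (u mu z : R) : 0 <= mu ->
  (u - soft_threshold u mu) * (z - soft_threshold u mu) <=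
  mu * (`|z| - `|soft_threshold u mu|).
Proof.
move=> mu_ge0; have [u_le|u_gt] := lerP `|u| mu.
  rewrite soft_threshold_small // !subr0 normr0 subr0.
  by rewrite (le_trans (ler_norm _)) // normrM ler_wpM2r.
rewrite (soft_threshold_large _ _ (ltW u_gt)).
(* Products count as atoms for [lra], so the bounds of [z] and [- z] by [|z|] are multiplied by [mu]
   beforehand. *)
have hz := ler_wpM2l mu_ge0 (ler_norm z).
have hNz := ler_wpM2l mu_ge0 (ler_norm (- z)); rewrite normrN in hNz.
have [u_eq0|u_gt0|u_lt0] := sgrP u.
- by move: u_gt; rewrite u_eq0 normr0 ltNge mu_ge0.
- rewrite gtr0_norm // in u_gt.
  rewrite mul1r (@ger0_norm _ (u - mu)); lra.
- rewrite ltr0_norm // in u_gt.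
  rewrite (@ler0_norm _ (u - -1 * mu)); lra.
Qed.

Lemma norm2_sqr {R : realType} {p : nat} (v : 'cV[R]_p) :
  norm2 v ^+ 2 = \sum_(j < p) v j 0 ^+ 2.
Proof. by rewrite sqr_sqrtr // sumr_ge0 // => j _; rewrite sqr_ge0. Qed.

Lemma bregman_objE {R : realType} {p : nat} (y : 'cV[R]_p) (l : R)
    (rho b : 'cV[R]_p) :
  bregman_obj y l rho b = \sum_(j < p)
    (2^-1 * (y j 0 - b j 0) ^+ 2 + l * (`|b j 0| - rho j 0 * b j 0)).
Proof.
rewrite /bregman_obj norm2_sqr /norm1 /dotp -sumrB !mulr_sumr -big_split /=.
by apply: eq_bigr => j _; rewrite !mxE.
Qed.

Lemma bregman_obj0 {R : realType} {p : nat} (y : 'cV[R]_p) (l : R)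
    (b : 'cV[R]_p) : bregman_obj y l 0 b = lasso_obj y l b.
Proof.
rewrite /bregman_obj /lasso_obj /dotp big1 ?subr0 // => j _.
by rewrite mxE mul0r.
Qed.

(** Expanding the square of [y - b] around [x] leaves, in each coordinate, exactly the subgradient
    inequality for the datum [y j 0 + l * rho j 0]. *)
Lemma bregman_obj_growth {R : realType} {p : nat} (y : 'cV[R]_p) (l : R)
    (rho b : 'cV[R]_p) (x := \col_j soft_threshold (y j 0 + l * rho j 0) l) :
  0 <= l ->
  bregman_obj y l rho x + 2^-1 * norm2 (b - x) ^+ 2 <= bregman_obj y l rho b.
Proof.
move=> l_ge0; rewrite !bregman_objE norm2_sqr mulr_sumr -big_split /=.
apply: ler_sum => j _; rewrite !mxE.
have := soft_threshold_subgradient (y j 0 + l * rho j 0) l (b j 0) l_ge0.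
by set t := soft_threshold _ _; lra.
Qed.

(** Quadratic growth shows that [x] is a minimiser, and that any other minimiser is at distance zero
    from it. *)
Lemma bregman_argminP {R : realType} {p : nat} (y : 'cV[R]_p) (l : R)
    (rho b : 'cV[R]_p) : 0 <= l ->
  is_argmin (bregman_obj y l rho) b <->
  b = \col_j soft_threshold (y j 0 + l * rho j 0) l.
Proof.
move=> l_ge0; set x := \col_j _.
have growth z : bregman_obj y l rho x + 2^-1 * norm2 (z - x) ^+ 2 <=
    bregman_obj y l rho z by exact: bregman_obj_growth.
split=> [/(_ x) b_min|-> z]; last first.
  by have := growth z; have := sqr_ge0 (norm2 (z - x)); lra.
have : norm2 (b - x) ^+ 2 = 0.
  by have := growth b; have := sqr_ge0 (norm2 (b - x)); lra.
rewrite norm2_sqr => /eqP; rewrite psumr_eq0 => [/allP h|j _]; last first.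
  by rewrite sqr_ge0.
apply/colP => j; have := h j (mem_index_enum j).
by rewrite sqrf_eq0 !mxE subr_eq0 => /eqP.
Qed.

Lemma lasso_argminP {R : realType} {p : nat} (y : 'cV[R]_p) (l : R)
    (b : 'cV[R]_p) : 0 <= l ->
  is_argmin (lasso_obj y l) b <-> b = \col_j soft_threshold (y j 0) l.
Proof.
move=> l_ge0; have -> : \col_j soft_threshold (y j 0) l =
    \col_j soft_threshold (y j 0 + l * (0 : 'cV[R]_p) j 0) l.
  by apply/colP => j; rewrite !mxE mulr0 addr0.
rewrite -bregman_argminP //.
by split=> h z; have := h z; rewrite !bregman_obj0.
Qed.

Lemma soft_threshold_refit {R : realType} (u l1 l2 : R)
    (mu := (l1^-1 + l2^-1)^-1) (gamma := 1 + l1 / l2) : 0 < l1 -> 0 < l2 ->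
  soft_threshold (u + l2 * (l1^-1 * (u - soft_threshold u l1))) l2 =
  if `|u| <= mu * gamma then gamma / (gamma - 1) * soft_threshold u mu else u.
Proof.
move=> l1_gt0 l2_gt0.
have l1_neq0 := lt0r_neq0 l1_gt0; have l2_neq0 := lt0r_neq0 l2_gt0.
have l12_neq0 : l1 + l2 != 0 by rewrite lt0r_neq0 ?addr_gt0.
have -> : mu * gamma = l1.
  by rewrite /mu /gamma; field; rewrite ?l1_neq0 ?l2_neq0 ?(addrC l2) ?l12_neq0.
have -> : gamma / (gamma - 1) = 1 + l2 / l1.
  by rewrite /gamma; field; rewrite ?addrK ?(addrC l2) ?l1_neq0 ?l2_neq0.
have [u_le|u_gt] := lerP `|u| l1.
  (* The first thresholding vanishes, so the shifted datum is [(1 + l2 / l1) * u]; as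
     [l2 = (1 + l2 / l1) * mu], the factor comes out by homogeneity. *)
  rewrite (soft_threshold_small _ _ u_le) -soft_thresholdZ; last first.
    by rewrite addr_gt0 // divr_gt0.
  congr soft_threshold; rewrite /mu; field => //.
  by rewrite ?l1_neq0 ?l2_neq0 ?(addrC l2) ?l12_neq0.
rewrite (soft_threshold_large _ _ (ltW u_gt)).
(* The residual of the first thresholding is [Num.sg u * l1], so the datum is shifted by
   [Num.sg u * l2], which the second thresholding cancels. *)
rewrite subKr (mulrC (Num.sg u)) mulKf // mulrC soft_threshold_shift //.
exact: ltW.
Qed.

Theorem proposition6 (R : realType) (p : nat) (y : 'cV[R]_p) (l1 l2 : R)
    (hl1 : 0 < l1) (hl2 : 0 < l2) :
  (exists! b1 : 'cV[R]_p, is_argmin (lasso_obj y l1) b1) /\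
  (forall b1 : 'cV[R]_p, is_argmin (lasso_obj y l1) b1 ->
   forall b : 'cV[R]_p,
     is_argmin (bregman_obj y l2 (lasso_rho y l1 b1)) b <->
     b = firm_threshold y (l1^-1 + l2^-1)^-1 (1 + l1 / l2)).
Proof.
have lassoP b1 := lasso_argminP y l1 b1 (ltW hl1).
split.
  exists (\col_j soft_threshold (y j 0) l1); split; first exact/lassoP.
  by move=> b1 /lassoP.
(* Uniqueness for the Lasso makes [b1], hence [lasso_rho], explicit. *)
move=> _ /lassoP -> b; rewrite bregman_argminP ?ltW //.
suff -> : firm_threshold y (l1^-1 + l2^-1)^-1 (1 + l1 / l2) =
    \col_j soft_threshold (y j 0 + l2 *
      lasso_rho y l1 (\col_i soft_threshold (y i 0) l1) j 0) l2 by [].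
by apply/colP => j; rewrite !mxE soft_threshold_refit.
Qed.
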